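(* Assume $\lambda_A>0$, that $\|\theta^*\|_2\le R$, and the geometric ergodicity assumption: there are constants $\kappa_0>0$ and $\rho\in(0,1)$ with $\sup_{s\in\mathcal S}d_{TV}(\mathbb P(s_t\in\cdot\mid s_0=s),\mu)\le\kappa_0\rho^t$ for all $t\ge0$. Run projected TD-SVRG with Markovian sampling (Algorithm 4) with step size $\alpha>0$ and inner-loop length $M$ satisfying $\alpha M\lambda_A=2$, and with the same estimation trajectory length $n$ in every epoch. Then for every $m\ge0$, $$\mathbb E[f_e(\tilde\theta_m)]\le\left(\tfrac34\right)^m f_e(\tilde\theta_0)+\frac{8C_2}{\lambda_A n}+4\alpha\Big(2G^2\big(4+6\tau^{\rm mix}(\alpha)\big)+9R^2\Big),$$ where $C_2=\frac{4(1+(\kappa_0-1)\rho)}{1-\rho}\,[4R^2+r_{\max}^2]$, $r_{\max}=\max_{s,s'}|r(s,s')|$, $G=r_{\max}+2R$, and $\tau^{\rm mix}(\alpha)=\min\{t\ge0:\kappa_0\rho^t\le\alpha\}$.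
   Context: Environment setting. Let $\mathcal S$ be a finite state space, $P$ an irreducible aperiodic transition matrix on $\mathcal S$ (induced by a fixed policy) with stationary distribution $\mu$, $\phi:\mathcal S\to\mathbb R^d$ a feature map with $\|\phi(s)\|_2\le1$ for all $s$, $r:\mathcal S\times\mathcal S\to\mathbb R$ a reward function and $\gamma\in[0,1)$. For states $s,s'$ and $\theta\in\mathbb R^d$ let $g_{s,s'}(\theta)=(r(s,s')+\gamma\phi(s')^T\theta-\phi(s)^T\theta)\phi(s)$. Let $A_e=\sum_{s,s'}\mu(s)P(s,s')\phi(s)(\phi(s)-\gamma\phi(s'))^T$ and $b_e=\sum_{s,s'}\mu(s)P(s,s')r(s,s')\phi(s)$; assume $A_e$ is nonsingular and let $\theta^*=A_e^{-1}b_e$. Let $\lambda_A$ be the minimum eigenvalue of $(A_e+A_e^T)/2$. Define $f_e(\theta)=(\theta-\theta^* )^TA_e(\theta-\theta^* )$. Let $\Pi_R(\theta)=\arg\min_{\|\theta'\|_2\le R}\|\theta-\theta'\|_2$ be Euclidean projection onto the ball of radius $R$. Algorithm 4 (TD-SVRG, Markovian sampling): a single Markov chain $s_0,s_1,\dots$ with transition matrix $P$ is run and all transitions used are consecutive pairs of this chain, taken in order. Given $\alpha>0$, integer $M\ge1$, estimation length $n$ and initial $\tilde\theta_0$ with $\|\tilde\theta_0\|\le R$, for epochs $m=1,2,\dots$: set $\tilde\theta=\tilde\theta_{m-1}$; take the next $n$ transitions of the chain as $\mathcal D^m$ and compute $g_m(\tilde\theta)=\frac1n\sum_{(s,s')\in\mathcal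 D^m}g_{s,s'}(\tilde\theta)$; set $\theta_0=\tilde\theta$; for $t=1,\dots,M$ take the next transition $(s,s')$ of the chain, put $v_t=g_{s,s'}(\theta_{t-1})-g_{s,s'}(\tilde\theta)+g_m(\tilde\theta)$ and $\theta_t=\Pi_R(\theta_{t-1}+\alpha v_t)$; finally set $\tilde\theta_m=\theta_{t'}$ with $t'$ uniform on $\{0,\dots,M-1\}$, independent. *)

(* Defs.v *)
From mathcomp Require Import all_boot all_order all_algebra.
From mathcomp Require Import reals.
Set Implicit Arguments. Unset Strict Implicit. Unset Printing Implicit Defensive.
Import Order.TTheory GRing.Theory Num.Theory.
Local Open Scope ring_scope.

Section TD.
Variables (R : realType) (S : finType) (d : nat).

Fixpoint Pn (P : S -> S -> R) (t : nat) : S -> S -> R :=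
  match t with
  | 0 => fun s s' => (s == s')%:R
  | t'.+1 => fun s s' => \sum_(u : S) Pn P t' s u * P u s'
  end.

Definition is_distr (p : S -> R) := (forall s, 0 <= p s) /\ \sum_(s : S) p s = 1.

Definition stochastic (P : S -> S -> R) :=
  forall s, is_distr (P s).

Definition irreducible (P : S -> S -> R) :=
  forall s s', exists t, 0 < Pn P t s s'.

Definition aperiodic (P : S -> S -> R) :=
  forall s (k : nat), (forall t, 0 < Pn P t.+1 s s -> (k %| t.+1)%N) -> k = 1%N.

Definition stationary (P : S -> S -> R) (mu : S -> R) :=
  is_distr mu /\ forall s', mu s' = \sum_(s : S) mu s * P s s'.

Definition dTV (p q : S -> R) : R :=
  \big[Num.max/0]_(A : {set S}) `|\sum_(s in A) (p s - q s)|.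

Definition dot (u v : 'cV[R]_d) : R := \sum_(i < d) u i 0 * v i 0.
Definition norm2 (u : 'cV[R]_d) : R := Num.sqrt (dot u u).

Definition is_ball_proj (Rad : R) (Pi : 'cV[R]_d -> 'cV[R]_d) :=
  forall th, norm2 (Pi th) <= Rad /\
    forall th', norm2 th' <= Rad -> norm2 (th - Pi th) <= norm2 (th - th').

Definition is_min_eigenvalue (B : 'M[R]_d) (lam : R) :=
  eigenvalue B lam /\ forall l, eigenvalue B l -> lam <= l.

Variables (mu : S -> R) (P : S -> S -> R) (phi : S -> 'cV[R]_d)
          (r : S -> S -> R) (gamma : R).

Definition gTD (s s' : S) (th : 'cV[R]_d) : 'cV[R]_d :=
  (r s s' + gamma * dot (phi s') th - dot (phi s) th) *: phi s.

Definition A_e : 'M[R]_d :=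
  \sum_(s : S) \sum_(s' : S) (mu s * P s s') *: (phi s *m (phi s - gamma *: phi s')^T).

Definition b_e : 'cV[R]_d :=
  \sum_(s : S) \sum_(s' : S) (mu s * P s s' * r s s') *: phi s.

Definition theta_star : 'cV[R]_d := invmx A_e *m b_e.

Definition f_e (th : 'cV[R]_d) : R :=
  ((th - theta_star)^T *m A_e *m (th - theta_star)) 0 0.

Definition rmax : R := \big[Num.max/0]_(s : S) \big[Num.max/0]_(s' : S) `|r s s'|.

(* The transition with index j is (st j, st j.+1).  Epoch k (k = 0,1,...) uses
   transitions k*(n+M) .. k*(n+M)+n-1 for the estimate g_m, then the next M
   transitions for the inner loop. *)
Variables (alpha Rad : R) (Pi : 'cV[R]_d -> 'cV[R]_d) (M n : nat).

Definition g_est (st : nat -> S) (base : nat) (th : 'cV[R]_d) : 'cV[R]_d :=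
  (n%:R)^-1 *: \sum_(j < n) gTD (st (base + j)%N) (st (base + j).+1) th.

Fixpoint inner (st : nat -> S) (base : nat) (tht gm : 'cV[R]_d) (t : nat)
  : 'cV[R]_d :=
  match t with
  | 0 => tht
  | t'.+1 =>
      let th := inner st base tht gm t' in
      let j := (base + n + t')%N in
      Pi (th + alpha *: (gTD (st j) (st j.+1) th - gTD (st j) (st j.+1) tht + gm))
  end.

(* tilde theta_k, given the chain st and the choices ch k in {0..M-1} of epoch k+1 *)
Fixpoint tilde_theta (st : nat -> S) (ch : nat -> nat) (th0 : 'cV[R]_d) (k : nat)
  : 'cV[R]_d :=
  match k with
  | 0 => th0
  | k'.+1 =>
      let tht := tilde_theta st ch th0 k' in
      let base := (k' * (n + M))%N in
      inner st base tht (g_est st base tht) (ch k')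
  end.

(* E[f_e(tilde theta_m)]: exact finite expectation over the first m(n+M)+1 states
   of the chain (initial law nu, transitions P) and the m independent uniform
   choices t' in {0,...,M-1}. *)
Definition expected_fe (nu : S -> R) (th0 : 'cV[R]_d) (m : nat) : R :=
  let T := (m * (n + M))%N in
  \sum_(p : {ffun 'I_T.+1 -> S}) \sum_(c : {ffun 'I_m -> 'I_M})
    (nu (p ord0) * (\prod_(j < T) P (p (inord j)) (p (inord j.+1)))
       * (M%:R^-1) ^+ m)
    * f_e (tilde_theta (fun j => p (inord j))
              (fun k => oapp (fun i : 'I_m => nat_of_ord (c i)) 0%N (insub k))
              th0 m).

End TD.

(* Main.v *)
Require Import Defs.
From mathcomp Require Import all_boot all_order all_algebra.
From mathcomp Require Import reals ring lra spectral complex sesquilinear.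
Import Order.TTheory GRing.Theory Num.Theory.
Local Open Scope ring_scope.
Set Implicit Arguments. Unset Strict Implicit. Unset Printing Implicit Defensive.

(** Write [x = theta_(t-1) - theta_star] and [e = g_m - gbar], the error of the
    epoch's gradient estimate.  Since the projection is a contraction towards
    [theta_star] and [x . gbar = - f_e], one inner step decreases [|x|^2] by
    [2 alpha f_e], up to a Markov bias, the term [2 alpha x . e] and
    [alpha^2 |v_t|^2 <= 9 alpha^2 G^2].  Young's inequality together with
    [f_e >= lamA |x|^2] trades [2 x . e] for [f_e / 2 + (2 / lamA) |e|^2].  The bias is
    bounded by comparing the iterate with the one [tau] steps earlier (or with
    the starting point of the epoch, where the bias vanishes): the iterate moves
    by at most [3 alpha G] per step, and after [tau] steps the chain is
    [alpha]-close to stationarity.  Summing over the inner loop, with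
    [alpha M lamA = 2], contracts the expectation of [f_e] by [1/3] per epoch.

    The second moment of [n e] is at most [8 n G^2 (1 + kappa0 rho / (1 - rho))]
    whatever the state at which the epoch starts: correlations at lag [k >= 2]
    decay like [rho ^ (k - 1)], lag one is absorbed in the diagonal terms, and
    the latter approach their stationary value, at most [G^2], geometrically. *)

(** * Euclidean geometry *)

Section Euclidean.
Variables (R : realType) (d : nat).
Implicit Types (u v w : 'cV[R]_d) (a : R).

Lemma dotE u v : dot u v = (u^T *m v) 0 0.
Proof. by rewrite !mxE; apply: eq_bigr => i _; rewrite mxE. Qed.

Lemma dotC u v : dot u v = dot v u.
Proof. by apply: eq_bigr => i _; rewrite mulrC. Qed.

Lemma dotDr u v w : dot u (v + w) = dot u v + dot u w.
Proof. by rewrite !dotE mulmxDr mxE. Qed.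

Lemma dotZr a u v : dot u (a *: v) = a * dot u v.
Proof. by rewrite !dotE -scalemxAr mxE. Qed.

Lemma dotNr u v : dot u (- v) = - dot u v.
Proof. by rewrite -scaleN1r dotZr mulN1r. Qed.

Lemma dotBr u v w : dot u (v - w) = dot u v - dot u w.
Proof. by rewrite dotDr dotNr. Qed.

Lemma dot0r u : dot u 0 = 0.
Proof. by rewrite -(scale0r 0) dotZr mul0r. Qed.

Lemma dotDl u v w : dot (v + w) u = dot v u + dot w u.
Proof. by rewrite dotC dotDr ![dot u _]dotC. Qed.

Lemma dotZl a u v : dot (a *: u) v = a * dot u v.
Proof. by rewrite dotC dotZr dotC. Qed.

Lemma dotNl u v : dot (- u) v = - dot u v.
Proof. by rewrite dotC dotNr dotC. Qed.

Lemma dotBl u v w : dot (v - w) u = dot v u - dot w u.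
Proof. by rewrite dotDl dotNl. Qed.

Lemma dot0l u : dot 0 u = 0.
Proof. by rewrite dotC dot0r. Qed.

Lemma dot_sumr (I : finType) (p : pred I) u (F : I -> 'cV[R]_d) :
  dot u (\sum_(i | p i) F i) = \sum_(i | p i) dot u (F i).
Proof. by apply: (big_morph (dot u)) => [v w|]; rewrite (dotDr, dot0r). Qed.

Lemma dot_suml (I : finType) (p : pred I) u (F : I -> 'cV[R]_d) :
  dot (\sum_(i | p i) F i) u = \sum_(i | p i) dot (F i) u.
Proof. by rewrite dotC dot_sumr; apply: eq_bigr => i _; rewrite dotC. Qed.

Lemma dot_ge0 u : 0 <= dot u u.
Proof. by apply: sumr_ge0 => i _; rewrite -expr2 sqr_ge0. Qed.

Lemma norm2_ge0 u : 0 <= norm2 u. Proof. exact: sqrtr_ge0. Qed.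

Lemma sqr_norm2 u : norm2 u ^+ 2 = dot u u.
Proof. by rewrite sqr_sqrtr ?dot_ge0. Qed.

Lemma norm2_0 : norm2 (0 : 'cV[R]_d) = 0.
Proof. by rewrite /norm2 dot0r sqrtr0. Qed.

Lemma norm2N u : norm2 (- u) = norm2 u.
Proof. by rewrite /norm2 dotNl dotNr opprK. Qed.

Lemma norm2_sub u v : norm2 (u - v) = norm2 (v - u).
Proof. by rewrite -norm2N opprB. Qed.

Lemma norm2Z a u : norm2 (a *: u) = `|a| * norm2 u.
Proof. by rewrite /norm2 dotZl dotZr mulrA -expr2 sqrtrM ?sqr_ge0 // sqrtr_sqr. Qed.

Lemma norm2_le u a : 0 <= a -> (norm2 u <= a) = (dot u u <= a ^+ 2).
Proof. by move=> a0; rewrite -sqr_norm2 ler_pXn2r // ?nnegrE ?norm2_ge0. Qed.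

Lemma le_norm2 u v : (norm2 u <= norm2 v) = (dot u u <= dot v v).
Proof. by rewrite norm2_le ?norm2_ge0 // sqr_norm2. Qed.

Lemma norm2_eq0 u : norm2 u = 0 -> u = 0.
Proof.
move=> u0; have /eqP : dot u u = 0 by rewrite -sqr_norm2 u0 expr0n.
rewrite psumr_eq0 => [/allP h|i _]; last by rewrite -expr2 sqr_ge0.
apply/colP => i; rewrite mxE; apply/eqP.
by have := h i (mem_index_enum i); rewrite /= mulf_eq0 orbb.
Qed.

(** Cauchy-Schwarz, from the nonnegative square of [norm2 v *: u - norm2 u *: v]; the cancellation
    of [norm2 u * norm2 v] is why zero norms are treated first. *)
Lemma dot_le u v : dot u v <= norm2 u * norm2 v.
Proof.
have [/norm2_eq0 ->|u0] := eqVneq (norm2 u) 0; first by rewrite dot0l norm2_0 mul0r.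
have [/norm2_eq0 ->|v0] := eqVneq (norm2 v) 0; first by rewrite dot0r norm2_0 mulr0.
have := dot_ge0 (norm2 v *: u - norm2 u *: v).
rewrite dotBl !dotBr !dotZl !dotZr -!sqr_norm2 (dotC v u) => h.
have ab : 0 < norm2 u * norm2 v by rewrite mulr_gt0 // lt_def ?u0 ?v0 norm2_ge0.
by rewrite -(ler_pM2l ab); lra.
Qed.

Lemma dot_norm_le u v : `|dot u v| <= norm2 u * norm2 v.
Proof.
by rewrite ler_norml lerNl -dotNl -{1}(norm2N u) !dot_le.
Qed.

Lemma norm2D u v : norm2 (u + v) <= norm2 u + norm2 v.
Proof.
rewrite norm2_le ?addr_ge0 ?norm2_ge0 // sqrrD !sqr_norm2.
by rewrite dotDl !dotDr (dotC v u); have := dot_le u v; lra.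
Qed.

Lemma norm2B u v : norm2 (u - v) <= norm2 u + norm2 v.
Proof. by rewrite -(norm2N v) norm2D. Qed.

Lemma norm2_sum (I : Type) (s : seq I) (F : I -> 'cV[R]_d) :
  norm2 (\sum_(i <- s) F i) <= \sum_(i <- s) norm2 (F i).
Proof.
elim/big_rec2: _ => [|i a u _ h]; first by rewrite norm2_0.
by apply: le_trans (norm2D _ _) _; rewrite lerD2l.
Qed.

Lemma dot_young u v a : 0 < a ->
  2 * dot u v <= 2^-1 * (a * dot u u) + 2 / a * dot v v.
Proof.
move=> a0; rewrite -(ler_pM2l a0).
have -> : a * (2^-1 * (a * dot u u) + 2 / a * dot v v)
    = 2^-1 * (a * (a * dot u u)) + 2 * dot v v.
  by field; rewrite gt_eqF.
have := dot_ge0 (a *: u - 2%:R *: v).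
by rewrite dotBl !dotBr !dotZl !dotZr (dotC v u); lra.
Qed.

(** Once the angle at [p] is obtuse, [|x - y|^2 >= |x - p|^2 + |p - y|^2]. Taking [theta_star] for
    [y] serves the descent, and the previous iterate serves the drift. *)
Lemma ball_proj_contract Rad (Pi : 'cV[R]_d -> 'cV[R]_d) x y :
  is_ball_proj Rad Pi -> norm2 y <= Rad -> norm2 (Pi x - y) <= norm2 (x - y).
Proof.
move=> /(_ x) [Pib Pimin] yb; set p := Pi x in Pib Pimin *.
have Rad0 : 0 <= Rad := le_trans (norm2_ge0 _) yb.
(* The obtuse-angle characterization of the projection, by moving from [p]
   towards [y] by a fraction [s]. *)
have var s : 0 < s -> s <= 1 -> 2 * dot (x - p) (y - p) <= s * dot (y - p) (y - p).
  move=> s0 s1.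
  have zb : norm2 (p + s *: (y - p)) <= Rad.
    have -> : p + s *: (y - p) = (1 - s) *: p + s *: y.
      by rewrite scalerBr scalerBl scale1r addrA addrAC.
    apply: le_trans (norm2D _ _) _.
    rewrite !norm2Z !ger0_norm ?subr_ge0 ?(ltW s0) //.
    have := ler_wpM2l (ltW s0) yb.
    have : (1 - s) * norm2 p <= (1 - s) * Rad by rewrite ler_wpM2l ?subr_ge0.
    by lra.
  have := Pimin _ zb; rewrite opprD addrA le_norm2.
  rewrite [dot (_ - _ *: _) _]dotBl !(dotBr _ (x - p) (s *: _)) !dotZl !dotZr.
  rewrite (dotC (y - p) (x - p)) => h.
  by rewrite -(ler_pM2l s0); lra.
have obtuse : dot (x - p) (y - p) <= 0.
  rewrite leNgt; apply/negP => c0.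
  have D0 := dot_ge0 (y - p).
  set c := dot _ _ in c0 var; set D := dot _ _ in D0 var.
  (* A positive [c] is refuted by the fraction [s = c / (c + D)], which stays in [(0, 1]] even when
     [D = 0]. *)
  have cD : 0 < c + D by lra.
  have := var (c / (c + D)) (divr_gt0 c0 cD).
  rewrite ler_pdivrMr // mul1r => /(_ ltac:(lra)) h.
  have : 2 * c * (c + D) <= c * D.
    by rewrite -ler_pdivlMr // mulrAC.
  by have := mulr_gt0 c0 c0; have := mulr_ge0 (ltW c0) D0; lra.
rewrite norm2_sub le_norm2.
have -> : x - y = (x - p) - (y - p) by rewrite opprB addrA subrK.
rewrite [leRHS]dotBl !(dotBr _ (x - p) (y - p)) (dotC (y - p) (x - p)).
by have := dot_ge0 (x - p); lra.
Qed.

End Euclidean.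

(** * Rayleigh quotients of real symmetric matrices, through complex diagonalization *)

Section Rayleigh.
Variable R : realType.
Local Notation C := R[i].
Local Notation rc := (real_complex R).
Local Notation "M ^t*" := (map_mx Num.conj M^T) (at level 30).

(** In the coordinates [y = U u] of a unitary diagonalization of the complexified [B], the two sides
    are the sums of [lam * |y_i|^2] and [D_i * |y_i|^2], so [lam <= D_i] suffices. *)
Lemma min_eigenvalue_dot_le d (B : 'M[R]_d) lam (u : 'cV[R]_d) :
  B^T = B -> is_min_eigenvalue B lam -> lam * dot u u <= dot u (B *m u).
Proof.
move=> Bsym [_ lamP].
pose A : 'M[C]_d := map_mx rc B.
have Aherm : A \is hermsymmx.
  apply: realsym_hermsym.
    by apply/is_hermitianmxP; rewrite expr0 scale1r map_mx_id // map_trmx Bsym.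
  by apply/mxOverP => i j; rewrite !mxE complex_real.
have An := hermitian_normalmx Aherm.
have Ae := orthomx_spectralP An.
set U := spectralmx A in Ae; set D := spectral_diag A in Ae.
have Dr := hermitian_spectral_diag_real Aherm.
have Uu : U \in unitmx := spectral_unit A.
have UV : invmx U = U ^t* := invmx_unitary (spectral_unitarymx A).
have lamD i : rc lam <= D 0 i.
  have Di : rc (complex.Re (D 0 i)) = D 0 i.
    by apply: RRe_real; have /mxOverP := Dr; apply.
  (* A real diagonal entry is an eigenvalue of [B] itself, since the embedding of the reals
     preserves and reflects eigenvalues; its left eigenvector is a row of [U]. *)
  rewrite -Di lecR; apply: lamP; rewrite -(eigenvalue_map rc) /= Di.
  apply/eigenvalueP; exists (row i U); last first.
    apply: contraTneq Uu => r0; rewrite -row_free_unit; apply/row_freeP => -[V].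
    move/(congr1 (row i)); rewrite row_mul r0 mul0mx => /rowP/(_ i).
    by rewrite !mxE eqxx => /esym/eqP; rewrite oner_eq0.
  rewrite -/A -row_mul {1}Ae !mulmxA mulmxV // mul1mx.
  by apply/rowP => j; rewrite mul_diag_mx !mxE.
pose y := U *m map_mx rc u.
have uT : (map_mx rc u)^T *m invmx U = y ^t*.
  rewrite UV /y trmx_mul map_mxM; congr (_ *m _).
  apply/matrixP => i j; rewrite !mxE; apply/esym/CrealP; by rewrite complex_real.
have norm_y : rc (dot u u) = \sum_i `|y i 0| ^+ 2.
  rewrite dotE -[RHS](_ : (y ^t* *m y) 0 0 = _); last first.
    by rewrite !mxE; apply: eq_bigr => i _; rewrite !mxE normCKC.
  rewrite -uT /y -mulmxA mulKmx // map_trmx -map_mxM [in RHS]mxE //.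
have quad_y : rc (dot u (B *m u)) = \sum_i D 0 i * `|y i 0| ^+ 2.
  rewrite dotE -[RHS](_ : (y ^t* *m (diag_mx D *m y)) 0 0 = _); last first.
    rewrite mul_diag_mx !mxE; apply: eq_bigr => i _.
    by rewrite !mxE normCKC mulrCA.
  rewrite -uT (_ : _ *m _ = (map_mx rc u)^T *m (A *m map_mx rc u)); last first.
    by rewrite [in RHS]Ae !mulmxA.
  by rewrite map_trmx -!map_mxM [in RHS]mxE.
rewrite -lecR rmorphM /= norm_y quad_y mulr_sumr; apply: ler_sum => i _.
by rewrite ler_wpM2r // exprn_ge0.
Qed.
End Rayleigh.

(** * Conditional expectations along the chain *)

Section Chain.
Variables (R : realType) (S : finType) (P : S -> S -> R).
Implicit Types (st : nat -> S) (F : (nat -> S) -> R) (k j : nat).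

Definition upd st j s := fun i => if i == j then s else st i.

Definition agree j st st' := forall i, (i <= j)%N -> st' i = st i.

(* [EX k j F st] is the conditional expectation of [F] over the states
   [j.+1, ..., j + k] of the chain given that the states up to [j] are those
   of [st]. *)
Fixpoint EX k j F st : R :=
  if k is k'.+1 then \sum_s P (st j) s * EX k' j.+1 F (upd st j.+1 s) else F st.

Lemma agree_upd j st st' s : agree j.+1 (upd st j.+1 s) st' -> agree j st st'.
Proof.
by move=> h i ij; rewrite h /upd ?leqW // ltn_eqF.
Qed.

Lemma EX_tower k1 k2 j F st : EX (k1 + k2) j F st = EX k1 j (EX k2 (j + k1) F) st.
Proof.
elim: k1 j st => [|k IH] j st /=; first by rewrite addn0.
by apply: eq_bigr => s _; rewrite IH addSnnS.
Qed.

Lemma EXD k j F F' st : EX k j (fun x => F x + F' x) st = EX k j F st + EX k j F' st.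
Proof.
elim: k j st => //= k IH j st; rewrite -big_split /=.
by apply: eq_bigr => s _; rewrite IH mulrDr.
Qed.

Lemma EXZ a k j F st : EX k j (fun x => a * F x) st = a * EX k j F st.
Proof.
elim: k j st => //= k IH j st; rewrite mulr_sumr.
by apply: eq_bigr => s _; rewrite IH mulrCA.
Qed.

Lemma EX_eq_agree k j F F' st :
  (forall st', agree j st st' -> F st' = F' st') -> EX k j F st = EX k j F' st.
Proof.
elim: k j st => /= [|k IH] j st h; first exact: h.
by apply: eq_bigr => s _; rewrite (IH _ (upd _ _ _)) // => st' /agree_upd /h.
Qed.

Lemma EX_eq k j F F' st : F =1 F' -> EX k j F st = EX k j F' st.
Proof. by move=> h; apply: EX_eq_agree => st' _. Qed.

Lemma EX_sum (I : Type) (s : seq I) (F : I -> (nat -> S) -> R) k j st :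
  EX k j (fun x => \sum_(i <- s) F i x) st = \sum_(i <- s) EX k j (F i) st.
Proof.
elim: s => [|i s IH].
  rewrite big_nil (@EX_eq _ _ _ (fun _ => 0 * 0)) => [|x]; first by rewrite EXZ mul0r.
  by rewrite big_nil mul0r.
rewrite big_cons -IH -EXD; apply: EX_eq => st'; by rewrite big_cons.
Qed.

Lemma EX_law k j (H : S -> R) st :
  EX k j (fun x => H (x (j + k)%N)) st = \sum_s Pn P k (st j) s * H s.
Proof.
elim: k H => [|k IH] H.
  rewrite /= addn0 (bigD1 (st j)) //= eqxx mul1r big1 ?addr0 // => s.
  by rewrite eq_sym => /negPf ->; rewrite mul0r.
rewrite -addn1 EX_tower (@EX_eq _ _ _ (fun x => \sum_s P (x (j + k)%N) s * H s)).
  rewrite (IH (fun u => \sum_s P u s * H s)) addn1 /=.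
  under eq_bigr do rewrite mulr_sumr.
  rewrite exchange_big; apply: eq_bigr => s _ /=; rewrite mulr_suml.
  by apply: eq_bigr => u _; rewrite mulrA.
by move=> x /=; apply: eq_bigr => s _; rewrite /upd addnA addn1 eqxx.
Qed.

Hypothesis P_stoch : stochastic P.

Lemma EX_le_agree k j F F' st :
  (forall st', agree j st st' -> F st' <= F' st') -> EX k j F st <= EX k j F' st.
Proof.
elim: k j st => /= [|k IH] j st h; first exact: h.
apply: ler_sum => s _; apply: ler_wpM2l; first by have [] := P_stoch (st j).
by apply: IH => st' /agree_upd /h.
Qed.

Lemma EX_le k j F F' st : (forall x, F x <= F' x) -> EX k j F st <= EX k j F' st.
Proof. by move=> h; apply: EX_le_agree => st' _. Qed.

Lemma EX_cst k j c st : EX k j (fun=> c) st = c.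
Proof.
elim: k j st => //= k IH j st; under eq_bigr do rewrite IH.
by rewrite -mulr_suml; have [_ ->] := P_stoch (st j); rewrite mul1r.
Qed.

Lemma EX_known k j F st :
  (forall st', agree j st st' -> F st' = F st) -> EX k j F st = F st.
Proof. by move=> h; rewrite (EX_eq_agree k h) EX_cst. Qed.

Lemma EX_transition k l j (H : S -> S -> R) st :
  EX (k + l.+1) j (fun x => H (x (j + k)%N) (x (j + k).+1)) st
  = \sum_s Pn P k (st j) s * \sum_s' P s s' * H s s'.
Proof.
rewrite EX_tower -(EX_law k j (fun s => \sum_s' P s s' * H s s')).
apply: EX_eq => x /=; apply: eq_bigr => s _; congr (_ * _).
rewrite EX_known => [|st' h]; first by rewrite /upd eqxx ltn_eqF.
by rewrite !h.
Qed.

Lemma Pn_sum1 k s : \sum_s' Pn P k s s' = 1.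
Proof.
have := EX_law k 0 (fun=> 1) (fun=> s); rewrite EX_cst => {1}->.
by apply: eq_bigr => s' _; rewrite mulr1.
Qed.

End Chain.

(** As [p] and [q] have equal mass, [F] may be shifted by [a]. Then only the states with [q s < p s]
    contribute positively, each with a factor at most [b - a], and their set is a competitor in the
    maximum [dTV p q]. *)
Lemma dTV_osc (R : realType) (S : finType) (p q F : S -> R) (a b : R) :
  \sum_s p s = 1 -> \sum_s q s = 1 -> (forall s, a <= F s <= b) ->
  \sum_s p s * F s - \sum_s q s * F s <= (b - a) * dTV p q.
Proof.
move=> p1 q1 Fab.
have -> : \sum_s p s * F s - \sum_s q s * F s = \sum_s (p s - q s) * (F s - a).
  under [RHS]eq_bigr do rewrite mulrBr !mulrBl opprB.
  rewrite !big_split /= !sumrN -[\sum_s p s * a]mulr_suml -[\sum_s q s * a]mulr_suml p1 q1; lra.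
pose A := [set s | q s < p s].
have ab : 0 <= b - a.
  have [s _|S0] := pickP (mem S); last first.
    by move: p1; rewrite big_pred0 // => /esym/eqP; rewrite oner_eq0.
  by rewrite subr_ge0; have /andP[] := Fab s; apply: le_trans.
apply: (@le_trans _ _ (\sum_(s in A) (p s - q s) * (b - a))).
  rewrite (bigID (mem A)) /= -[leRHS]addr0 lerD //.
    apply: ler_sum => s; rewrite inE => qp; rewrite ler_wpM2l ?subr_ge0 ?(ltW qp) //.
    by have /andP[aF Fb] := Fab s; lra.
  apply: sumr_le0 => s; rewrite inE -leNgt => qp.
  by rewrite mulr_le0_ge0 ?subr_ge0 ?subr_le0 //; have /andP[] := Fab s.
rewrite -mulr_suml mulrC ler_wpM2l //; apply: le_trans (ler_norm _) _.
exact: (le_bigmax _ (fun A : {set S} => `|\sum_(s in A) (p s - q s)|) A).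
Qed.

(** * Splitting off the last entry of a path or of a choice sequence *)

Section FfunSnoc.
Variables (T : finType) (k : nat).

Definition ffsnoc (p : {ffun 'I_k -> T}) (x : T) : {ffun 'I_k.+1 -> T} :=
  [ffun i => if unlift ord_max i is Some j then p j else x].

Lemma ffsnoc_lt p x (i : 'I_k.+1) (h : (i < k)%N) : ffsnoc p x i = p (Ordinal h).
Proof.
rewrite ffunE; case: unliftP => [j ij|ij]; last by exfalso; move: h; rewrite ij ltnn.
congr (p _); apply: val_inj => /=; rewrite ij /= /bump leqNgt ltn_ord //.
Qed.

Lemma ffsnoc_max p x : ffsnoc p x ord_max = x.
Proof. by rewrite ffunE unlift_none. Qed.

Lemma sum_ffsnoc (R : realType) (G : {ffun 'I_k.+1 -> T} -> R) :
  \sum_p G p = \sum_p \sum_x G (ffsnoc p x).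
Proof.
rewrite pair_big /= (reindex (fun px => ffsnoc px.1 px.2)) //=.
exists (fun p : {ffun 'I_k.+1 -> T} => ([ffun i => p (lift ord_max i)], p ord_max)).
  move=> [p x] _ /=; rewrite ffsnoc_max; congr (_, _); apply/ffunP => i.
  by rewrite !ffunE liftK.
move=> p _; apply/ffunP => i; rewrite ffunE /=.
by case: unliftP => [j|] ->; rewrite ?ffunE.
Qed.

End FfunSnoc.

Lemma sum_ffun0 (R : realType) (T : finType) (G : {ffun 'I_0 -> T} -> R) a :
  (forall p, G p = a) -> \sum_p G p = a.
Proof.
move=> Ga; under eq_bigr do rewrite Ga.
by rewrite sumr_const card_ffun card_ord expn0 mulr1n.
Qed.

(** Links the explicit sum over paths to [EX], by splitting off the last state. Past [T], [inord]
    returns a default index and the path [fun=> s] is still constant; the agreement hypothesis makes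
    [F] blind to both. *)
Lemma sum_path_EX (R : realType) (S : finType) (P : S -> S -> R) (nu : S -> R) T
    (F : (nat -> S) -> R) :
  (forall st st', agree T st st' -> F st' = F st) ->
  \sum_(p : {ffun 'I_T.+1 -> S})
     nu (p ord0) * (\prod_(j < T) P (p (inord j)) (p (inord j.+1)))
       * F (fun j => p (inord j))
  = \sum_s nu s * EX P T 0 F (fun=> s).
Proof.
elim: T F => [|T IH] F Fagree.
  rewrite sum_ffsnoc; apply: sum_ffun0 => p; apply: eq_bigr => s _.
  rewrite big_ord0 mulr1 /= (_ : ord0 = ord_max) ?ffsnoc_max; last exact: val_inj.
  congr (_ * _); apply: Fagree => i _; rewrite (_ : inord i = ord_max) ?ffsnoc_max //.
  by apply: val_inj; rewrite ord1.
rewrite sum_ffsnoc.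
under [RHS]eq_bigr do rewrite -addn1 EX_tower add0n.
rewrite -IH => [|st st' h]; last first.
  rewrite /= h //; apply: eq_bigr => s _; congr (_ * _); apply: Fagree => i.
  by rewrite /upd leq_eqVlt; case: eqP => //= _ /h.
apply: eq_bigr => p _; rewrite /= mulr_sumr; apply: eq_bigr => s _.
have old i : (i <= T)%N -> ffsnoc p s (inord i) = p (inord i).
  move=> iT; have h : ((inord i : 'I_T.+2) < T.+1)%N by rewrite inordK // ltnS ltnW.
  by rewrite (ffsnoc_lt _ _ h); congr (p _); apply: val_inj; rewrite /= !inordK // ltnS ltnW.
have new : ffsnoc p s (inord T.+1) = s.
  by rewrite (_ : inord _ = ord_max) ?ffsnoc_max //; apply: val_inj; rewrite /= inordK.
rewrite big_ord_recr /= new old // !mulrA.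
congr (_ * _ * _ * _).
- by rewrite (@ffsnoc_lt _ _ p s ord0 (ltn0Sn T)); congr (nu (p _)); apply: val_inj.
- by apply: eq_bigr => j _; rewrite !old // ltnW.
- apply: Fagree => i iT; rewrite /upd; case: eqP => [->|/eqP iT1]; first by rewrite new.
  by rewrite old // -ltnS ltn_neqAle iT1.
Qed.

(** * Mean-path operators, mixing and variance *)

Section TemporalDifference.
Variables (R : realType) (S : finType) (d : nat).
Variables (P : S -> S -> R) (mu : S -> R) (phi : S -> 'cV[R]_d) (r : S -> S -> R).
Variables (gamma Rad : R).
Hypothesis P_stoch : stochastic P.
Hypothesis mu_stat : stationary P mu.
Hypothesis phi_le1 : forall s, norm2 (phi s) <= 1.
Hypothesis gamma01 : 0 <= gamma < 1.
Hypothesis A_unit : A_e mu P phi gamma \in unitmx.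
Hypothesis thetas_ball : norm2 (theta_star mu P phi r gamma) <= Rad.

Local Notation A := (A_e mu P phi gamma).
Local Notation thetas := (theta_star mu P phi r gamma).
Local Notation fe := (f_e mu P phi r gamma).
Local Notation g := (gTD phi r gamma).
Local Notation G := (rmax r + 2%:R * Rad).
Implicit Types (u v w th : 'cV[R]_d) (H : S -> S -> R).

Lemma Rad_ge0 : 0 <= Rad. Proof. exact: le_trans (norm2_ge0 _) thetas_ball. Qed.

Lemma r_le_rmax s s' : `|r s s'| <= rmax r.
Proof.
apply: le_trans (le_bigmax _ (fun s0 => \big[Num.max/0]_s' `|r s0 s'|) s).
exact: (le_bigmax _ (fun s0 => `|r s s0|) s').
Qed.

Lemma rmax_ge0 : 0 <= rmax r. Proof. exact: bigmax_ge_id. Qed.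

Lemma G_ge0 : 0 <= G.
Proof. by have := Rad_ge0; have := rmax_ge0; lra. Qed.

Lemma Rad_le_G : 2 * Rad <= G.
Proof. by have := rmax_ge0; lra. Qed.

Definition muP H := \sum_s mu s * \sum_s' P s s' * H s s'.

Lemma muP_le H c : (forall s s', H s s' <= c) -> muP H <= c.
Proof.
move=> Hc; have [[mu0 mu1] _] := mu_stat.
rewrite -[leRHS]mul1r -mu1 mulr_suml; apply: ler_sum => s _.
rewrite ler_wpM2l //; have [P0 P1] := P_stoch s.
rewrite -[leRHS]mul1r -P1 mulr_suml; apply: ler_sum => s' _.
by rewrite ler_wpM2l.
Qed.

Lemma muP_lin a b H H' : muP (fun s s' => a * H s s' + b * H' s s') = a * muP H + b * muP H'.
Proof.
rewrite /muP !mulr_sumr -big_split; apply: eq_bigr => s _ /=.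
rewrite !mulr_sumr -big_split; apply: eq_bigr => s' _ /=; ring.
Qed.

Lemma muP_cst c : muP (fun _ _ => c) = c.
Proof.
have [[mu0 mu1] _] := mu_stat; rewrite /muP.
under eq_bigr => s _ do rewrite -mulr_suml (P_stoch s).2 mul1r.
by rewrite -mulr_suml mu1 mul1r.
Qed.

Lemma eq_muP H H' : (forall s s', H s s' = H' s s') -> muP H = muP H'.
Proof.
move=> e; apply: eq_bigr => s _; congr (_ * _); apply: eq_bigr => s' _; by rewrite e.
Qed.

Lemma muP_dot x (V : S -> S -> 'cV[R]_d) :
  muP (fun s s' => dot x (V s s')) = dot x (\sum_s \sum_s' (mu s * P s s') *: V s s').
Proof.
rewrite dot_sumr; apply: eq_bigr => s _; rewrite dot_sumr mulr_sumr.
by apply: eq_bigr => s' _; rewrite dotZr mulrA.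
Qed.

(* [lbar] and [gbar] are the stationary means of [lin] and [gTD], see [lbarE]
   and [gbarE]. *)
Definition lin s s' u := (gamma * dot (phi s') u - dot (phi s) u) *: phi s.
Definition lbar u := - (A *m u).
Definition gbar th := lbar (th - thetas).

(** The reward cancels, so that, apart from the estimate, the variance-reduced direction involves
    the current transition only through the linear map [lin]. *)
Lemma gTD_sub s s' th w : g s s' th - g s s' w = lin s s' (th - w).
Proof.
rewrite /gTD -scalerBl; congr (_ *: _); rewrite !dotBr; ring.
Qed.

Lemma lbarE u : lbar u = \sum_s \sum_s' (mu s * P s s') *: lin s s' u.
Proof.
rewrite /lbar mulmx_suml -sumrN; apply: eq_bigr => s _.
rewrite mulmx_suml -sumrN; apply: eq_bigr => s' _.
rewrite -scalemxAl -scalerN -mulmxA; congr (_ *: _).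
rewrite [_^T *m u]mx11_scalar mul_mx_scalar -scaleNr; congr (_ *: _).
rewrite -dotE dotBl dotZl; ring.
Qed.

Lemma gbarE th : gbar th = \sum_s \sum_s' (mu s * P s s') *: g s s' th.
Proof.
have -> : gbar th = lbar th + b_e mu P phi r.
  rewrite /gbar /lbar mulmxBr opprB addrC; congr (_ + _).
  by rewrite /theta_star mulKVmx.
rewrite lbarE -big_split; apply: eq_bigr => s _ /=.
rewrite -big_split; apply: eq_bigr => s' _ /=.
rewrite -!scalerA -scalerDr -scalerDr -scalerDl /lin /gTD.
by congr (_ *: (_ *: (_ *: _))); ring.
Qed.

Lemma lbarB u v : lbar (u - v) = lbar u - lbar v.
Proof. by rewrite /lbar mulmxBr opprB opprK addrC. Qed.

Lemma gbar_sub th w : gbar th - gbar w = lbar (th - w).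
Proof. by rewrite /gbar -lbarB; congr lbar; rewrite opprB addrA subrK. Qed.

Lemma dot_lbar x u : dot x (lbar u) = muP (fun s s' => dot x (lin s s' u)).
Proof. by rewrite lbarE muP_dot. Qed.

Lemma dot_gbar x th : dot x (gbar th) = muP (fun s s' => dot x (g s s' th)).
Proof. by rewrite gbarE muP_dot. Qed.

Lemma f_e_gbar th : fe th = - dot (th - thetas) (gbar th).
Proof. by rewrite /f_e /gbar /lbar dotNr opprK dotE mulmxA. Qed.

Lemma linB s s' u v : lin s s' (u - v) = lin s s' u - lin s s' v.
Proof. by rewrite /lin -scalerBl; congr (_ *: _); rewrite !dotBr; ring. Qed.

Lemma norm2_lin s s' u : norm2 (lin s s' u) <= 2 * norm2 u.
Proof.
rewrite norm2Z -[leRHS]mulr1; apply: ler_pM => //; first exact: norm2_ge0.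
have bound s0 : `|dot (phi s0) u| <= norm2 u.
  apply: le_trans (dot_norm_le _ _) _.
  by rewrite -[leRHS]mul1r ler_wpM2r ?norm2_ge0.
have /andP[g0 g1] := gamma01.
apply: le_trans (ler_normB _ _) _; rewrite normrM (ger0_norm g0).
have := bound s; have := ler_pM g0 (normr_ge0 _) (ltW g1) (bound s'); lra.
Qed.

Lemma norm2_g s s' th : norm2 th <= Rad -> norm2 (g s s' th) <= G.
Proof.
move=> thb; rewrite norm2Z -[leRHS]mulr1; apply: ler_pM => //; first exact: norm2_ge0.
have bound s0 : `|dot (phi s0) th| <= Rad.
  apply: le_trans (dot_norm_le _ _) _.
  by rewrite -[leRHS]mul1r ler_pM ?norm2_ge0.
have /andP[g0 g1] := gamma01.
apply: le_trans (ler_normB _ _) _.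
apply: le_trans (lerD (ler_normD _ _) (lexx _)) _; rewrite normrM (ger0_norm g0).
have := bound s; have := ler_pM g0 (normr_ge0 _) (ltW g1) (bound s').
by have := r_le_rmax s s'; lra.
Qed.

(** Reduces the norm of a stationary mean to bounds on scalars, to which [muP_le] applies; the test
    vector is [v] itself. *)
Lemma norm2_le_dual v c : 0 <= c -> (forall x, dot x v <= norm2 x * c) -> norm2 v <= c.
Proof.
move=> c0 /(_ v); rewrite -sqr_norm2 expr2.
have [->|v0] := eqVneq (norm2 v) 0; first by rewrite c0.
by rewrite ler_pM2l // lt_def v0 norm2_ge0.
Qed.

Lemma norm2_lbar u : norm2 (lbar u) <= 2 * norm2 u.
Proof.
apply: norm2_le_dual => [|x]; first by rewrite mulr_ge0 ?norm2_ge0.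
rewrite dot_lbar; apply: muP_le => s s'; apply: le_trans (dot_le _ _) _.
by rewrite ler_wpM2l ?norm2_ge0 ?norm2_lin.
Qed.

Lemma norm2_gbar th : norm2 th <= Rad -> norm2 (gbar th) <= G.
Proof.
move=> thb; apply: norm2_le_dual => [|x]; first exact: G_ge0.
rewrite dot_gbar; apply: muP_le => s s'; apply: le_trans (dot_le _ _) _.
by rewrite ler_wpM2l ?norm2_ge0 ?norm2_g.
Qed.

Definition dev th s s' := g s s' th - gbar th.

Lemma norm2_dev th s s' : norm2 th <= Rad -> norm2 (dev th s s') <= 2 * G.
Proof.
move=> thb; apply: le_trans (norm2B _ _) _.
by have := norm2_g s s' thb; have := norm2_gbar thb; lra.
Qed.

Lemma dot_dev_le th s s' : norm2 th <= Rad -> dot (dev th s s') (dev th s s') <= 4 * G ^+ 2.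
Proof.
move=> thb; rewrite (_ : 4 * G ^+ 2 = (2 * G) ^+ 2); last by ring.
by rewrite -norm2_le ?norm2_dev // mulr_ge0 ?G_ge0.
Qed.

Lemma muP_dev th x : muP (fun s s' => dot x (dev th s s')) = 0.
Proof.
rewrite (@eq_muP _ (fun s s' => 1 * dot x (g s s' th) + -1 * dot x (gbar th))).
  by rewrite muP_lin muP_cst -dot_gbar; ring.
by move=> s s'; rewrite dotBr; ring.
Qed.

(** Centering subtracts [|gbar|^2] from the mean of [|g|^2], which gains a factor 4 over the
    pointwise [dot_dev_le]. *)
Lemma muP_dev2 th : norm2 th <= Rad ->
  muP (fun s s' => dot (dev th s s') (dev th s s')) <= G ^+ 2.
Proof.
move=> thb.
rewrite (@eq_muP _ (fun s s' =>
    1 * dot (g s s' th) (g s s' th) + -1 * (2 * dot (gbar th) (g s s' th)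
      + -1 * dot (gbar th) (gbar th)))); last first.
  by move=> s s'; rewrite !(dotBr, dotBl) (dotC (g s s' th) (gbar th)); ring.
rewrite muP_lin muP_lin muP_cst -dot_gbar.
suff : muP (fun s s' => dot (g s s' th) (g s s' th)) <= G ^+ 2.
  by have := dot_ge0 (gbar th); lra.
by apply: muP_le => s s'; rewrite -norm2_le ?G_ge0 ?norm2_g.
Qed.

(** * Mixing estimates in total variation *)

Section Mixing.
Variables (kappa0 rho : R).
Hypothesis kappa0_gt0 : 0 < kappa0.
Hypothesis rho01 : 0 < rho < 1.
Hypothesis mix : forall (t : nat) (s : S), dTV (Pn P t s) mu <= kappa0 * rho ^+ t.

(** Averaging [H] over the arrival state leaves a function of the departure state with values in
    [[a, b]]; the law of that state is compared with [mu] by [dTV_osc]. *)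
Lemma EX_mix k l j H a b st : (forall s s', a <= H s s' <= b) ->
  EX P (k + l.+1) j (fun x => H (x (j + k)%N) (x (j + k).+1)) st
  <= muP H + (b - a) * (kappa0 * rho ^+ k).
Proof.
move=> Hab; rewrite EX_transition //.
have PHab s : a <= \sum_s' P s s' * H s s' <= b.
  have [P0 P1] := P_stoch s.
  rewrite -[a]mul1r -[b]mul1r -P1 !mulr_suml.
  by apply/andP; split; apply: ler_sum => s' _; rewrite ler_wpM2l //;
    have /andP[] := Hab s s'.
have ab : 0 <= b - a.
  by rewrite subr_ge0; have /andP[] := PHab (st j); apply: le_trans.
have [[_ mu1] _] := mu_stat.
have := dTV_osc (Pn_sum1 P_stoch k (st j)) mu1 PHab.
by have := ler_wpM2l ab (mix k (st j)); rewrite /muP; lra.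
Qed.

(** * Second moment of the summed deviations of one estimation batch *)

Section Variance.
Variables (w : 'cV[R]_d) (n j : nat) (st : nat -> S).
Hypothesis w_ball : norm2 w <= Rad.
Local Notation h i := (fun x : nat -> S => dev w (x (j + i)%N) (x (j + i).+1)).
Local Notation E := (fun F => EX P n j F st).

Lemma E_dev2 i : (i < n)%N ->
  E (fun x => dot (h i x) (h i x)) <= G ^+ 2 * (1 + 4 * (kappa0 * rho ^+ i)).
Proof.
move=> ltin; have -> : n = (i + (n - i.+1).+1)%N by rewrite -addSnnS subnKC.
have := @EX_mix i (n - i.+1) j (fun s s' => dot (dev w s s') (dev w s s')) 0 (4 * G ^+ 2) st.
move/(_ _)/le_trans; apply=> [s s'|]; first by rewrite dot_ge0 dot_dev_le.
by have := muP_dev2 w_ball; lra.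
Qed.

(** Conditioning on the states up to the end of transition [i] freezes [h i]. Then [m - i.+1] steps
    remain before transition [m] starts, and the stationary mean of its deviation is zero. *)
Lemma E_dev_cross i m : (i < m)%N -> (m < n)%N ->
  E (fun x => dot (h i x) (h m x)) <= 4 * G ^+ 2 * (kappa0 * rho ^+ (m - i.+1)).
Proof.
move=> ltim ltmn.
have -> : n = (i.+1 + ((m - i.+1) + (n - m.+1).+1))%N.
  by rewrite addnA subnKC // -addSnnS subnKC.
rewrite EX_tower -[leRHS](EX_cst P_stoch i.+1 j _ st); apply: EX_le => // st'.
pose v := h i st'.
rewrite (@EX_eq_agree _ _ _ _ _ _ (fun x => dot v (h m x))); last first.
  by move=> x hx; rewrite /v (hx (j + i)%N) ?(hx (j + i).+1) // addnS ?leqnSn.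
have -> : m = (i.+1 + (m - i.+1))%N by rewrite subnKC.
rewrite addnA addKn.
have vG : norm2 v <= 2 * G by exact: norm2_dev.
(* Only the [g] part of the deviation varies, and its product with [v] is at most [2 * G * G] in
   size; translating by [dot v (gbar w)] keeps the interval of length [4 * G ^+ 2]. *)
have := @EX_mix (m - i.+1) (n - (i.+1 + (m - i.+1)).+1) (j + i.+1) (fun s s' => dot v (dev w s s'))
  (- (2 * G * G) - dot v (gbar w)) (2 * G * G - dot v (gbar w)) st'.
rewrite muP_dev; move/(_ _)/le_trans; apply => [s s'|].
  rewrite dotBr lerD2r lerD2r -ler_norml.
  apply: le_trans (dot_norm_le _ _) _.
  by rewrite ler_pM ?norm2_ge0 ?norm2_g.
by rewrite expr2; lra.
Qed.

Lemma geometric_le m : \sum_(i < m) rho ^+ (m - i) <= rho / (1 - rho).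
Proof.
have /andP[r0 r1] := rho01.
have c0 : 0 < 1 - rho by rewrite subr_gt0.
rewrite ler_pdivlMr //.
suff -> : (\sum_(i < m) rho ^+ (m - i)) * (1 - rho) = rho - rho ^+ m.+1.
  by have := exprn_ge0 m.+1 (ltW r0); lra.
elim: m => [|m IH]; first by rewrite big_ord0 mul0r expr1 subrr.
rewrite big_ord_recl subn0 mulrDl.
under eq_bigr do rewrite /= /bump subSS.
by rewrite IH !exprS; ring.
Qed.

(** With [s] the sum of the first [m] terms and [a], [b] the last two, the square grows by
    [|b|^2 + 2 a.b + 2 s.b]. The lag-one product is bounded by [|a|^2 + |b|^2], since mixing would
    give [kappa0] without a factor [rho]; the products in [s.b] have lag at least two. *)
Lemma E_sum_dev_step m : (m.+1 < n)%N ->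
  E (fun x => dot (\sum_(i < m.+2) h i x) (\sum_(i < m.+2) h i x))
  <= E (fun x => dot (\sum_(i < m.+1) h i x) (\sum_(i < m.+1) h i x))
     + E (fun x => dot (h m x) (h m x)) + 2 * E (fun x => dot (h m.+1 x) (h m.+1 x))
     + 8 * G ^+ 2 * kappa0 * (rho / (1 - rho)).
Proof.
move=> ltmn.
have cross : \sum_(i < m) E (fun x => dot (h i x) (h m.+1 x))
    <= 4 * G ^+ 2 * kappa0 * (rho / (1 - rho)).
  apply: (@le_trans _ _ (\sum_(i < m) 4 * G ^+ 2 * kappa0 * rho ^+ (m - i))).
    apply: ler_sum => i _; rewrite -[leRHS]mulrA -subSS.
    by apply: E_dev_cross => //; rewrite ltnS ltnW.
  rewrite -mulr_sumr ler_wpM2l ?geometric_le //.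
  by rewrite mulr_ge0 ?(ltW kappa0_gt0) // mulr_ge0 ?exprn_ge0 // G_ge0.
rewrite -(EX_sum P (index_enum 'I_m) (fun (i : 'I_m) x => dot (h i x) (h m.+1 x))) in cross.
apply: (@le_trans _ _ (E (fun x => dot (\sum_(i < m.+1) h i x) (\sum_(i < m.+1) h i x)
    + (dot (h m x) (h m x) + (2 * dot (h m.+1 x) (h m.+1 x)
    + 2 * \sum_(i < m) dot (h i x) (h m.+1 x)))))).
  apply: EX_le => // x.
  rewrite -dot_suml.
  rewrite !(@big_ord_recr _ _ _ m.+1) /= !(@big_ord_recr _ _ _ m) /=.
  move: (\sum_(i < m) _) (dev w _ _) (dev w _ _) => s a b.
  have := dot_ge0 (a - b).
  rewrite !(dotBl, dotDl, dotBr, dotDr) (dotC b a) (dotC b s) (dotC a s); lra.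
by rewrite !EXD !EXZ; lra.
Qed.

Lemma variance_sum_dev :
  E (fun x => dot (\sum_(i < n) h i x) (\sum_(i < n) h i x))
  <= 8 * n%:R * G ^+ 2 * (1 + kappa0 * rho / (1 - rho)).
Proof.
have /andP[r0 r1] := rho01.
have c0 : 0 < 1 - rho by rewrite subr_gt0.
pose c := kappa0 / (1 - rho).
have kE : kappa0 = c * (1 - rho) by rewrite /c divfK // gt_eqF.
have cpos : 0 < c by rewrite divr_gt0.
have G20 : 0 <= G ^+ 2 by rewrite exprn_ge0 ?G_ge0.
have -> : kappa0 * rho / (1 - rho) = c * rho by rewrite mulrAC.
have trivial m : E (fun x => dot (\sum_(i < m) h i x) (\sum_(i < m) h i x))
    <= 4 * m%:R ^+ 2 * G ^+ 2.
  rewrite -[leRHS](EX_cst P_stoch n j _ st); apply: EX_le => // x.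
  have -> : 4 * m%:R ^+ 2 * G ^+ 2 = (m%:R * (2 * G)) ^+ 2 by ring.
  rewrite -norm2_le; last by rewrite mulr_ge0 // mulr_ge0 // G_ge0.
  apply: le_trans (norm2_sum _ _) _.
  rewrite mulr_natl -[m in leRHS]card_ord -sumr_const.
  by apply: ler_sum => i _; apply: norm2_dev.
(* For [n <= 1], [n ^ 2 = n] and the pointwise bound suffices; otherwise the induction starts from
   two terms. *)
case: (ltnP 1 n) => n2; last first.
  apply: le_trans (trivial n) _.
  have -> : n%:R ^+ 2 = n%:R :> R by case: (n) n2 => [|[|]] // _; rewrite ?expr0n ?expr1n.
  have := mulr_ge0 (mulr_ge0 (ler0n R n) G20) (mulr_ge0 (ltW cpos) (ltW r0)).
  by have := mulr_ge0 (ler0n R n) G20; lra.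
(* The last term absorbs the geometric excess of the diagonal terms over [G ^+ 2]. *)
have inv m : (m.+2 <= n)%N ->
  E (fun x => dot (\sum_(i < m.+2) h i x) (\sum_(i < m.+2) h i x))
  <= G ^+ 2 * (16 + 3 * m%:R + 8 * (c * rho) * m%:R + 12 * (c * rho - c * rho ^+ m.+1)).
  elim: m => [_|m IH ltmn].
    by apply: le_trans (trivial 2%N) _; rewrite expr1; lra.
  have := E_sum_dev_step ltmn.
  have := E_dev2 ltmn; have := E_dev2 (ltnW ltmn); have := IH (ltnW ltmn).
  rewrite -[8 * _ * _ * _]mulrA (_ : kappa0 * (rho / (1 - rho)) = c * rho); last first.
    by rewrite /c; ring.
  have e0 := exprn_ge0 m.+1 (ltW r0).
  (* Up to [G ^+ 2], the diagonal excess [c (1 - rho) rho^(m+1) (4 + 8 rho)] is charged to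
     [12 c (1 - rho) rho^(m+1)]; the slack is eight times this product. *)
  have := mulr_ge0 (mulr_ge0 G20 (ltW cpos)) (mulr_ge0 e0 (exprn_ge0 2 (ltW c0))).
  rewrite kE !(exprS rho m.+1) -[m.+1%:R]natr1; move: (rho ^+ m.+1) e0 => e e0.
  lra.
case: n n2 inv => [|[|m]] // _ /(_ m (leqnn _)) /le_trans; apply.
have := mulr_ge0 (mulr_ge0 G20 (ltW cpos)) (exprn_ge0 m.+1 (ltW r0)).
have := mulr_ge0 (mulr_ge0 G20 (ltW cpos)) (ltW r0).
have := mulr_ge0 G20 (ler0n R m).
rewrite (natrD R 2 m : m.+2%:R = _); move: (rho ^+ m.+1) => e; lra.
Qed.
End Variance.

(** * Inner loop: drift, Markov bias and descent *)

Section Iteration.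
Variables (lamA alpha : R) (Pi : 'cV[R]_d -> 'cV[R]_d) (tau M n : nat).
Hypothesis Pi_proj : is_ball_proj Rad Pi.
Hypothesis lamA_gt0 : 0 < lamA.
Hypothesis f_e_ge : forall th, lamA * dot (th - thetas) (th - thetas) <= fe th.
Hypothesis alpha_gt0 : 0 < alpha.
Hypothesis n_gt0 : (0 < n)%N.
Hypothesis alphaM : alpha * M%:R * lamA = 2.
Hypothesis tau_mix : kappa0 * rho ^+ tau <= alpha.

Section InnerLoop.
Variables (base : nat) (w gm : 'cV[R]_d).
Hypothesis w_ball : norm2 w <= Rad.
Hypothesis gm_le : norm2 gm <= G.
Local Notation theta t y := (inner phi r gamma alpha Pi n y base w gm t).
Local Notation lin_at t y :=
  (lin (y (base + n + t)%N) (y (base + n + t).+1)).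

Lemma inner_ball t y : norm2 (theta t y) <= Rad.
Proof. by case: t => [|t] //=; exact: (Pi_proj _).1. Qed.

Lemma inner_agree t y y' : agree (base + n + t) y y' -> theta t y' = theta t y.
Proof.
elim: t => //= t IH h; rewrite IH => [|i it]; last first.
  by apply: h; rewrite addnS ltnW.
by rewrite !h ?addnS.
Qed.

(** The vector [v_t] of the algorithm, in the form given by [gTD_sub]. *)
Definition direction t y := lin_at t y (theta t y - w) + gm.

Lemma innerS t y : theta t.+1 y = Pi (theta t y + alpha *: direction t y).
Proof. by rewrite /= gTD_sub. Qed.

Lemma norm2_ball_sub u v : norm2 u <= Rad -> norm2 v <= Rad -> norm2 (u - v) <= 2 * Rad.
Proof. by move=> ub vb; apply: le_trans (norm2B _ _) _; lra. Qed.

Lemma norm2_direction t y : norm2 (direction t y) <= 3 * G.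
Proof.
apply: le_trans (norm2D _ _) _.
have := norm2_lin (y (base + n + t)%N) (y (base + n + t).+1) (theta t y - w).
have := norm2_ball_sub (inner_ball t y) w_ball.
have := Rad_le_G; have := gm_le; lra.
Qed.

(** The previous iterate lies in the ball, so projecting cannot lengthen a step beyond
    [alpha * (3 * G)]. *)
Lemma inner_drift k t y : norm2 (theta (t + k) y - theta t y) <= k%:R * (alpha * (3 * G)).
Proof.
elim: k => [|k IH]; first by rewrite addn0 subrr norm2_0 mul0r.
rewrite addnS innerS -(subrK (theta (t + k) y) (Pi _)) -addrA.
apply: le_trans (norm2D _ _) _; rewrite -natr1 mulrDl mul1r [leRHS]addrC lerD //.
apply: le_trans (ball_proj_contract _ Pi_proj (inner_ball _ _)) _.
rewrite addrC addKr norm2Z gtr0_norm // ler_pM2l //; exact: norm2_direction.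
Qed.

(* The centered noise of the update direction, tested against [th - theta_star]. *)
Definition bias th s s' :=
  dot (th - thetas) (lin s s' (th - w) - lbar (th - w)).

Lemma norm2_lin_sub s s' u : norm2 (lin s s' u - lbar u) <= 4 * norm2 u.
Proof.
apply: le_trans (norm2B _ _) _.
by have := norm2_lin s s' u; have := norm2_lbar u; lra.
Qed.

(** Both factors of [bias] depend on [th]; changing one at a time costs [8 * Rad * D] each, and
    [16 * Rad <= 8 * G]. *)
Lemma bias_lipschitz th th' s s' : norm2 th <= Rad -> norm2 th' <= Rad ->
  bias th s s' <= bias th' s s' + 8 * G * norm2 (th - th').
Proof.
move=> thb thb'; set D := norm2 (th - th').
have D0 : 0 <= D by exact: norm2_ge0.
have -> : bias th s s' = bias th' s s'
    + (dot (th - th') (lin s s' (th - w) - lbar (th - w))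
    + dot (th' - thetas) (lin s s' (th - th') - lbar (th - th'))).
  rewrite /bias; have -> : th' - w = (th - w) - (th - th').
    by rewrite opprB [RHS]addrC subrKA.
  rewrite (linB _ _ (th - w) (th - th')) (lbarB (th - w) (th - th')).
  have split_dot a : dot (th - th') a = dot (th - thetas) a - dot (th' - thetas) a.
    by rewrite -dotBl opprB addrA subrK.
  by rewrite split_dot !dotBr; ring.
rewrite lerD2l.
have h1 := le_trans (dot_le (th - th') _) (ler_wpM2l D0 (norm2_lin_sub s s' (th - w))).
have h2 := le_trans (dot_le (th' - thetas) _)
  (ler_wpM2l (norm2_ge0 _) (norm2_lin_sub s s' (th - th'))).
have h3 := ler_wpM2l D0 (norm2_ball_sub thb w_ball).
have h4 := ler_wpM2r D0 (norm2_ball_sub thb' thetas_ball).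
have h5 := ler_wpM2l D0 Rad_le_G.
rewrite -/D in h1 h2 *; lra.
Qed.

Lemma bias_start s s' : bias w s s' = 0.
Proof.
by rewrite /bias (subrr w) /lin /lbar !dot0r mulr0 subrr scale0r mulmx0 !oppr0 addr0 dot0r.
Qed.

(** The part [24 * tau] is the drift over at most [tau] steps, [8 * G * (3 * G)] for each; the part
    [4] is the mixing error, from [16 * Rad ^+ 2 <= 4 * G ^+ 2]. *)
Lemma E_bias t st : (t < M)%N ->
  EX P M (base + n)
    (fun y => bias (theta t y) (y (base + n + t)%N) (y (base + n + t).+1)) st
  <= alpha * G ^+ 2 * (4 + 24 * tau%:R).
Proof.
move=> ltM.
have aG : 0 <= alpha * G ^+ 2 by rewrite mulr_ge0 ?exprn_ge0 ?G_ge0 // ltW.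
have drift k m y s s' : (k <= tau)%N ->
    bias (theta (m + k) y) s s' <= bias (theta m y) s s' + alpha * G ^+ 2 * (24 * tau%:R).
  move=> ktau; apply: le_trans (bias_lipschitz s s' (inner_ball (m + k) y) (inner_ball m y)) _.
  rewrite lerD2l.
  have G8 : 0 <= 8 * G by rewrite mulr_ge0 ?G_ge0.
  apply: le_trans (ler_wpM2l G8 (inner_drift k m y)) _.
  have kt : k%:R <= tau%:R :> R by rewrite ler_nat.
  by have := ler_wpM2l aG kt; lra.
(* Early iterates are compared with the start [w] of the loop, where the bias vanishes
   identically. *)
case: (ltnP t tau) => [ttau|taut].
  rewrite -[leRHS](EX_cst P_stoch M (base + n) _ st); apply: EX_le => // y.
  have := drift t 0%N y (y (base + n + t)%N) (y (base + n + t).+1) (ltnW ttau).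
  by rewrite bias_start add0n; lra.
have tE : ((t - tau) + tau)%N = t by rewrite subnK.
pose F y := bias (theta (t - tau)%N y) (y (base + n + t)%N) (y (base + n + t).+1).
apply: (@le_trans _ _ (EX P M (base + n) (fun y => F y + alpha * G ^+ 2 * (24 * tau%:R)) st)).
  by apply: EX_le => // y; rewrite /F -{1}tE; apply: drift.
rewrite EXD EX_cst // mulrDr lerD2r.
have -> : M = ((t - tau) + (tau + (M - t.+1).+1))%N.
  by rewrite addnA tE -addSnnS subnKC.
rewrite EX_tower -[leRHS](EX_cst P_stoch (t - tau) (base + n) _ st); apply: EX_le => // st'.
(* Given the states up to [base + n + (t - tau)], the earlier iterate is a fixed vector, while the
   transition under test starts [tau] steps later. *)
pose th := theta (t - tau)%N st'.
have thb : norm2 th <= Rad by exact: inner_ball.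
rewrite (@EX_eq_agree _ _ _ _ _ _ (fun y => bias th (y (base + n + (t - tau) + tau)%N)
   (y (base + n + (t - tau) + tau).+1))); last first.
  by move=> y hy; rewrite /F (inner_agree hy) -(addnA (base + n)) tE.
pose c := dot (th - thetas) (lbar (th - w)).
have := @EX_mix tau (M - t.+1) (base + n + (t - tau)) (bias th)
  (- (8 * Rad ^+ 2) - c) (8 * Rad ^+ 2 - c) st'.
have -> : muP (bias th) = 0.
  rewrite (@eq_muP _ (fun s s' => 1 * dot (th - thetas) (lin s s' (th - w)) + -1 * c)).
    by rewrite muP_lin muP_cst -dot_lbar /c; ring.
  by move=> s s'; rewrite /bias dotBr /c; ring.
move/(_ _)/le_trans; apply => [s s'|].
  rewrite /bias dotBr lerD2r lerD2r -ler_norml; apply: le_trans (dot_norm_le _ _) _.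
  have h1 := norm2_ball_sub thb thetas_ball.
  have h2 := le_trans (norm2_lin s s' (th - w)) (ler_wpM2l (ler0n R 2) (norm2_ball_sub thb w_ball)).
  have := ler_pM (norm2_ge0 _) (norm2_ge0 _) h1 h2; lra.
have R0 := Rad_ge0.
have h1 : (2 * Rad) ^+ 2 <= G ^+ 2 by rewrite ler_pXn2r ?nnegrE ?Rad_le_G ?G_ge0 // mulr_ge0.
have h2 := ler_wpM2l (ltW alpha_gt0) h1.
have h3 := ler_wpM2l (exprn_ge0 2 R0) tau_mix.
lra.
Qed.

Local Notation e := (gm - gbar w).
Local Notation dist2 t := (fun y => dot (theta t y - thetas) (theta t y - thetas)).
Local Notation err := (2 / lamA * dot e e + alpha * (17 + 48 * tau%:R) * G ^+ 2).

Lemma descent t y :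
  dist2 t.+1 y <= dist2 t y + - (3 / 2 * alpha) * fe (theta t y)
    + 2 * alpha * bias (theta t y) (y (base + n + t)%N) (y (base + n + t).+1)
    + (2 * alpha / lamA * dot e e + 9 * alpha ^+ 2 * G ^+ 2).
Proof.
have contr := ball_proj_contract (theta t y + alpha *: direction t y) Pi_proj thetas_ball.
rewrite -innerS le_norm2 in contr; apply: le_trans contr _.
have -> : theta t y + alpha *: direction t y - thetas
    = (theta t y - thetas) + alpha *: direction t y.
  by rewrite addrAC.
have v2 : dot (direction t y) (direction t y) <= 9 * G ^+ 2.
  have := norm2_direction t y; rewrite norm2_le ?mulr_ge0 ?G_ge0 //; lra.
have := ler_wpM2l (exprn_ge0 2 (ltW alpha_gt0)) v2.
rewrite !(dotDl _ (theta t y - thetas)) !(dotDr _ (theta t y - thetas)) !dotZl !dotZr.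
rewrite (dotC (direction t y) (theta t y - thetas)).
(* The direction is [gbar (theta t y)] plus the centered [lin] plus [e], because
   [lbar (theta t y - w)] is a difference of values of [gbar]. *)
have -> : dot (theta t y - thetas) (direction t y)
  = - fe (theta t y) + bias (theta t y) (y (base + n + t)%N) (y (base + n + t).+1)
    + dot (theta t y - thetas) e.
  rewrite f_e_gbar opprK -!dotDr /direction -gbar_sub; congr dot.
  move: (lin _ _ _) (gbar _) (gbar w) => a b c.
  by apply/colP => i; rewrite !mxE; ring.
have young : 2 * dot (theta t y - thetas) e
    <= 2^-1 * fe (theta t y) + 2 / lamA * dot e e.
  have := f_e_ge (theta t y); have := dot_young (theta t y - thetas) e lamA_gt0; lra.
have := ler_wpM2l (ltW alpha_gt0) young; rewrite expr2; lra.
Qed.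

(** The squared distances telescope, the last one is dropped, and the first is at most
    [fe w / lamA]. With [alpha * M * lamA = 2], three times the average is then at most
    [fe w + 2 * err]. *)
Lemma E_inner_sum st :
  M%:R^-1 * EX P M (base + n) (fun y => \sum_(t < M) fe (theta t y)) st
  <= 3^-1 * fe w + 2 / 3 * err.
Proof.
pose E F := EX P M (base + n) F st.
(* In [err], [17 + 48 * tau] is [9] from the squared step plus twice the [4 + 24 * tau] of
   [E_bias]. *)
have step t : (t < M)%N ->
    3 / 2 * alpha * E (fun y => fe (theta t y)) <= E (dist2 t) - E (dist2 t.+1) + alpha * err.
  move=> ltM; have := EX_le P_stoch M (base + n) st (descent t).
  rewrite !EXD !EX_cst // !EXZ /E.
  have := ler_wpM2l (ltW alpha_gt0) (E_bias st ltM); lra.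
have tele m : (m <= M)%N ->
    3 / 2 * alpha * \sum_(t < m) E (fun y => fe (theta t y))
    <= E (dist2 0%N) - E (dist2 m) + m%:R * (alpha * err).
  elim: m => [_|m IH ltm]; first by rewrite big_ord0 mulr0 mul0r subrr addr0.
  rewrite big_ord_recr /= mulrDr -natr1; have := IH (ltnW ltm); have := step m ltm; lra.
have M0 : 0 < M%:R :> R.
  rewrite lt_def ler0n andbT; apply: contra_eq_neq alphaM => ->.
  by rewrite mulr0 mul0r eq_sym pnatr_eq0.
have d0 : E (dist2 0%N) = dot (w - thetas) (w - thetas) by rewrite /E /= EX_cst.
have dM : 0 <= E (dist2 M).
  rewrite -(EX_cst P_stoch M (base + n) 0 st); apply: EX_le => // y; exact: dot_ge0.
have := tele M (leqnn _); rewrite d0 /E -EX_sum -/(E _).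
set X := E _ => h.
have aM : alpha = 2 / (lamA * M%:R).
  by rewrite -alphaM; field; rewrite !gt_eqF.
have fw := f_e_ge w.
have -> : M%:R^-1 * X = 3^-1 * (lamA * (3 / 2 * alpha * X)).
  rewrite aM; field; by rewrite !gt_eqF.
have := ler_wpM2l (ltW lamA_gt0) h.
have -> : lamA * (dot (w - thetas) (w - thetas) - E (dist2 M) + M%:R * (alpha * err))
  = lamA * dot (w - thetas) (w - thetas) - lamA * E (dist2 M) + (alpha * M%:R * lamA) * err.
  ring.
rewrite alphaM; have := mulr_ge0 (ltW lamA_gt0) dM; lra.
Qed.

End InnerLoop.

(** * One epoch: gradient estimate followed by the inner loop *)

Local Notation est y base w := (g_est phi r gamma n y base w).
Local Notation gamma_n := (1 + kappa0 * rho / (1 - rho)).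
(** This is [err] with [dot e e] replaced by the bound of [variance_sum_dev] divided by [n ^ 2]. *)
Local Notation noise :=
  (2 / lamA * (8 * G ^+ 2 * gamma_n / n%:R) + alpha * (17 + 48 * tau%:R) * G ^+ 2).

Lemma n_ne0 : n%:R != 0 :> R. Proof. by rewrite pnatr_eq0 -lt0n. Qed.

Lemma M_gt0 : 0 < M%:R :> R.
Proof.
rewrite lt_def ler0n andbT; apply: contra_eq_neq alphaM => ->.
by rewrite mulr0 mul0r eq_sym pnatr_eq0.
Qed.

Lemma norm2_est base w y : norm2 w <= Rad -> norm2 (est y base w) <= G.
Proof.
move=> wb; rewrite norm2Z ger0_norm ?invr_ge0 // mulrC ler_pdivrMr ?ltr0n //.
apply: le_trans (norm2_sum _ _) _.
rewrite mulr_natr -[n in leRHS]card_ord -sumr_const.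
by apply: ler_sum => i _; apply: norm2_g.
Qed.

Lemma est_agree base w y y' : agree (base + n) y y' -> est y' base w = est y base w.
Proof.
move=> h; congr (_ *: _); apply: eq_bigr => i _.
by rewrite !h // -?addnS leq_add2l // ltnW.
Qed.

Lemma est_dev base w y :
  est y base w - gbar w = n%:R^-1 *: \sum_(i < n) dev w (y (base + i)%N) (y (base + i).+1).
Proof.
rewrite sumrB scalerBr sumr_const card_ord -scaler_nat scalerA mulVf ?n_ne0 //.
by rewrite scale1r.
Qed.

(** Conditioning on the first [n] transitions makes the estimate a fixed vector, as [E_inner_sum]
    requires; its squared error is then averaged over these transitions. *)
Lemma E_epoch base w st : norm2 w <= Rad ->
  EX P (n + M) base
    (fun y => M%:R^-1 * \sum_(t < M) fe (inner phi r gamma alpha Pi n y base w (est y base w) t)) st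
  <= 3^-1 * fe w + 2 / 3 * noise.
Proof.
move=> wb; rewrite EX_tower.
pose SS y := \sum_(i < n) dev w (y (base + i)%N) (y (base + i).+1).
apply: (@le_trans _ _ (EX P n base (fun y =>
    (3^-1 * fe w + 2 / 3 * (alpha * (17 + 48 * tau%:R) * G ^+ 2))
    + 4 / 3 / lamA * n%:R^-1 ^+ 2 * dot (SS y) (SS y)) st)).
  apply: EX_le => // st'.
  rewrite (@EX_eq_agree _ _ _ _ _ _ (fun y => M%:R^-1 * \sum_(t < M)
    fe (inner phi r gamma alpha Pi n y base w (est st' base w) t))); last first.
    by move=> y hy; rewrite (est_agree w hy).
  rewrite EXZ; apply: le_trans (E_inner_sum base wb (norm2_est base st' wb) st') _.
  by rewrite est_dev dotZl dotZr -/(SS st'); lra.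
rewrite EXD EX_cst // EXZ.
have c0 : 0 <= 4 / 3 / lamA * n%:R^-1 ^+ 2.
  by rewrite !mulr_ge0 ?exprn_ge0 ?invr_ge0 // ltW.
have := ler_wpM2l c0 (variance_sum_dev n base st wb); rewrite -/(SS _).
have -> : 4 / 3 / lamA * n%:R^-1 ^+ 2 * (8 * n%:R * G ^+ 2 * gamma_n)
    = 2 / 3 * (2 / lamA * (8 * G ^+ 2 * gamma_n / n%:R)).
  have /andP[_ r1] := rho01.
  by field; rewrite n_ne0 subr_eq0 !gt_eqF.
rewrite /SS; lra.
Qed.

(** * Recursion over the epochs *)

Section Epochs.
Variables (nu : S -> R) (th0 : 'cV[R]_d).
Hypothesis nu_distr : is_distr nu.
Hypothesis th0_ball : norm2 th0 <= Rad.

Local Notation tilde y ch k := (tilde_theta phi r gamma alpha Pi M n y ch th0 k).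

Definition choice m (c : {ffun 'I_m -> 'I_M}) (k : nat) : nat :=
  oapp (fun i : 'I_m => nat_of_ord (c i)) 0%N (insub k).

Lemma choice_snoc_lt m (c : {ffun 'I_m -> 'I_M}) i k :
  (k < m)%N -> choice (ffsnoc c i) k = choice c k.
Proof.
move=> km; have km1 : (k < m.+1)%N by exact: ltnW.
rewrite /choice !insubT /=; congr (nat_of_ord _).
rewrite (ffsnoc_lt _ _ (i := Ordinal km1) km); congr (c _); exact: val_inj.
Qed.

Lemma choice_snoc_max m (c : {ffun 'I_m -> 'I_M}) i : choice (ffsnoc c i) m = i.
Proof.
rewrite /choice insubT //= => h; congr (nat_of_ord _).
rewrite -[RHS](ffsnoc_max c i); congr (ffsnoc c i _); exact: val_inj.
Qed.

Lemma choice_lt m (c : {ffun 'I_m -> 'I_M}) k : (k < m)%N -> (choice c k < M)%N.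
Proof. by move=> km; rewrite /choice insubT /= ltn_ord. Qed.

Lemma tilde_ball y ch k : norm2 (tilde y ch k) <= Rad.
Proof. by elim: k => //= k IH; apply: inner_ball. Qed.

(** A choice below [M] keeps an epoch within its own block of [n + M] transitions, so [k] epochs
    read only the states up to [k * (n + M)]. *)
Lemma tilde_agree y y' ch ch' k :
  agree (k * (n + M)) y y' -> (forall i, (i < k)%N -> ch' i = ch i /\ (ch i < M)%N) ->
  tilde y' ch' k = tilde y ch k.
Proof.
elim: k => //= k IH hy hch.
have sub j : (j <= n + M)%N -> agree (k * (n + M) + j) y y'.
  by move=> jM i ij; apply: hy; rewrite mulSn addnC (leq_trans ij) // leq_add2l.
have [-> chM] := hch k (ltnSn k).
rewrite IH => [|i ik|i ik]; last 2 first.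
- by apply: (sub 0%N) => //; rewrite addn0.
- by apply: hch; rewrite ltnW.
rewrite (est_agree _ (sub n (leq_addr _ _))).
by apply: inner_agree; rewrite -addnA; apply: sub; rewrite leq_add2l ltnW.
Qed.

Local Notation EE m := (expected_fe mu P phi r gamma alpha Pi M n nu th0 m).

Lemma expected_fe_EX m :
  EE m = \sum_(c : {ffun 'I_m -> 'I_M}) M%:R^-1 ^+ m *
    \sum_s nu s * EX P (m * (n + M)) 0 (fun y => fe (tilde y (choice c) m)) (fun=> s).
Proof.
rewrite /expected_fe exchange_big /=; apply: eq_bigr => c _.
rewrite -sum_path_EX => [|y y' h]; last first.
  by congr fe; apply: tilde_agree => // i im; split => //; apply: choice_lt.
rewrite mulr_sumr; apply: eq_bigr => p _.
by rewrite mulrCA mulrA [_ * (_ ^+ m)]mulrC.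
Qed.

Lemma expected_fe_step m : EE m.+1 <= 3^-1 * EE m + 2 / 3 * noise.
Proof.
have [nu0 nu1] := nu_distr.
rewrite !expected_fe_EX sum_ffsnoc.
have mass : \sum_(c : {ffun 'I_m -> 'I_M}) M%:R^-1 ^+ m = 1 :> R.
  rewrite sumr_const card_ffun !card_ord -[_ *+ _]mulr_natr natrX -exprMn mulVf ?expr1n //.
  by rewrite gt_eqF ?M_gt0.
set N := 2 / 3 * noise.
(* The constant is spread over the probability weights of the choices and of the initial state, so
   that the two sides compare term by term. *)
have cN : N = \sum_(c : {ffun 'I_m -> 'I_M}) M%:R^-1 ^+ m * N.
  by rewrite -mulr_suml mass mul1r.
have sN : N = \sum_s nu s * N by rewrite -mulr_suml nu1 mul1r.
rewrite [X in _ + X]cN mulr_sumr -big_split /=.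
apply: ler_sum => c _.
rewrite -mulr_sumr exprS -mulrA mulrCA [3^-1 * _]mulrCA -mulrDr.
rewrite ler_wpM2l ?exprn_ge0 ?invr_ge0 //.
rewrite exchange_big mulr_sumr mulr_sumr [X in _ + X]sN -big_split /=.
apply: ler_sum => s _.
rewrite -mulr_sumr mulrCA [3^-1 * _]mulrCA -mulrDr ler_wpM2l //.
(* The average over the last choice moves inside the expectation, which is split at the start of the
   last epoch; there [tilde] is a fixed vector of the ball and [E_epoch] applies. *)
rewrite -EX_sum -EXZ mulSn addnC EX_tower add0n -[N](EX_cst P_stoch (m * (n + M)) 0 _ (fun=> s)).
rewrite -EXZ -EXD; apply: EX_le => // st.
apply: le_trans (E_epoch _ st (tilde_ball st (choice c) m)).
rewrite le_eqVlt; apply/orP; left; apply/eqP.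
apply: EX_eq_agree => y hy; congr (_ * _); apply: eq_bigr => i _.
rewrite /= choice_snoc_max (tilde_agree hy (ch := choice c)) // => k km.
by rewrite choice_snoc_lt // choice_lt.
Qed.

(** The recursion keeps [noise] fixed, as [1 / 3 + 2 / 3 = 1]; its rate [1 / 3] is relaxed to
    [3 / 4], using [0 <= fe th0]. *)
Lemma expected_fe_le m : EE m <= (3 / 4) ^+ m * fe th0 + noise.
Proof.
have f0 : 0 <= fe th0.
  by apply: le_trans (f_e_ge th0); rewrite mulr_ge0 ?dot_ge0 // ltW.
have noise0 : 0 <= noise.
  have /andP[r0 r1] := rho01.
  by rewrite addr_ge0 // !mulr_ge0 ?invr_ge0 ?exprn_ge0 ?addr_ge0 ?mulr_ge0 ?invr_ge0
    ?subr_ge0 ?rmax_ge0 ?Rad_ge0 ?(ltW lamA_gt0) ?(ltW kappa0_gt0) ?(ltW alpha_gt0)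
    ?(ltW r0) ?(ltW r1).
elim: m => [|m IH].
  rewrite expected_fe_EX (@sum_ffun0 _ _ _ (fe th0)) => [|c]; first by lra.
  by rewrite mul1r /= -mulr_suml nu_distr.2 mul1r.
apply: le_trans (expected_fe_step m) _.
have : 0 <= (3 / 4) ^+ m * fe th0 by rewrite mulr_ge0 ?exprn_ge0 ?divr_ge0.
rewrite [_ ^+ m.+1]exprS; move: noise (_ ^+ m) (EE m) IH => N q E; lra.
Qed.
End Epochs.
End Iteration.
End Mixing.
End TemporalDifference.

(** * The quadratic form of [A_e] and the final constants *)

Lemma f_e_ge_min_eigenvalue (R : realType) (S : finType) (d : nat)
    (P : S -> S -> R) (mu : S -> R) (phi : S -> 'cV[R]_d) (r : S -> S -> R)
    (gamma lamA : R) th :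
  is_min_eigenvalue ((2%:R)^-1 *: (A_e mu P phi gamma + (A_e mu P phi gamma)^T)) lamA ->
  lamA * dot (th - theta_star mu P phi r gamma) (th - theta_star mu P phi r gamma)
  <= f_e mu P phi r gamma th.
Proof.
rewrite /f_e; move: (th - _) (A_e _ _ _ _) => u A lamP.
apply: le_trans (min_eigenvalue_dot_le u _ lamP) _.
  by rewrite linearZ /= linearD /= trmxK addrC.
rewrite -scalemxAl mulmxDl dotZr dotDr !dotE mulmxA.
(* A scalar equals its transpose, so [A] and [A^T] have the same quadratic form. *)
rewrite [in X in _ + X](_ : u^T *m (A^T *m u) = (u^T *m A *m u)^T).
  by rewrite [in X in _ + X]mxE; lra.
by rewrite !trmx_mul trmxK.
Qed.

Theorem theorem3 (R : realType) (S : finType) (d : nat)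
  (P : S -> S -> R) (mu : S -> R) (phi : S -> 'cV[R]_d) (r : S -> S -> R)
  (gamma Rad : R) (Pi : 'cV[R]_d -> 'cV[R]_d)
  (lamA kappa0 rho alpha : R) (tau M n : nat)
  (nu : S -> R) (th0 : 'cV[R]_d) :
  stochastic P -> irreducible P -> aperiodic P -> stationary P mu ->
  (forall s, norm2 (phi s) <= 1) ->
  0 <= gamma < 1 ->
  A_e mu P phi gamma \in unitmx ->
  is_min_eigenvalue ((2%:R)^-1 *: (A_e mu P phi gamma + (A_e mu P phi gamma)^T)) lamA ->
  is_ball_proj Rad Pi ->
  0 < lamA ->
  norm2 (theta_star mu P phi r gamma) <= Rad ->
  0 < kappa0 -> 0 < rho < 1 ->
  (forall (t : nat) (s : S), dTV (Pn P t s) mu <= kappa0 * rho ^+ t) ->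
  0 < alpha -> (0 < M)%N -> (0 < n)%N ->
  alpha * M%:R * lamA = 2%:R ->
  kappa0 * rho ^+ tau <= alpha ->
  (forall t : nat, kappa0 * rho ^+ t <= alpha -> (tau <= t)%N) ->
  is_distr nu ->
  norm2 th0 <= Rad ->
  forall m : nat,
    let C2 := 4%:R * (1 + (kappa0 - 1) * rho) / (1 - rho)
              * (4%:R * Rad ^+ 2 + rmax r ^+ 2) in
    let G := rmax r + 2%:R * Rad in
    expected_fe mu P phi r gamma alpha Pi M n nu th0 m
    <= (3%:R / 4%:R) ^+ m * f_e mu P phi r gamma th0
       + 8%:R * C2 / (lamA * n%:R)
       + 4%:R * alpha * (2%:R * G ^+ 2 * (4%:R + 6%:R * tau%:R) + 9%:R * Rad ^+ 2).

Proof.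
move=> P_stoch _ _ mu_stat phi1 gamma01 A_unit lamP Pi_proj lamA0 thetas_ball k0 rho01
  mix alpha0 _ n0 alphaM tau_mix _ nu_distr th0_ball m; cbv zeta.
set C2 := 4 * _ / _ * _; set G := rmax r + _.
have f_ge th := f_e_ge_min_eigenvalue r th lamP.
apply: le_trans (expected_fe_le P_stoch mu_stat phi1 gamma01 A_unit thetas_ball k0 rho01 mix
  Pi_proj lamA0 f_ge alpha0 n0 alphaM tau_mix nu_distr th0_ball m) _.
rewrite -[leRHS]addrA lerD2l -/G.
have /andP[r0 r1] := rho01.
have n0R : 0 < n%:R :> R by rewrite ltr0n.
have K0 : 0 <= 1 + kappa0 * rho / (1 - rho).
  by rewrite addr_ge0 // !mulr_ge0 ?invr_ge0 ?subr_ge0 ?(ltW k0) ?(ltW r0) ?(ltW r1).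
have G2 : G ^+ 2 <= 2 * (4 * Rad ^+ 2 + rmax r ^+ 2).
  by have := sqr_ge0 (rmax r - 2 * Rad); rewrite /G; lra.
(* Here [(1 + (kappa0 - 1) * rho) / (1 - rho)] is rewritten as [1 + kappa0 * rho / (1 - rho)]. *)
have C2E : 8 * C2 / (lamA * n%:R)
    = 2 / lamA * (8 * (2 * (4 * Rad ^+ 2 + rmax r ^+ 2)) * (1 + kappa0 * rho / (1 - rho)) / n%:R).
  by rewrite /C2; field; rewrite subr_eq0 !gt_eqF.
apply: lerD.
  rewrite C2E ler_wpM2l ?divr_ge0 ?(ltW lamA0) // ler_wpM2r ?invr_ge0 // ler_wpM2r //.
  by rewrite ler_wpM2l.
(* The [tau] terms agree, [8 * 6 = 48], and [17 <= 32]; the term in [Rad ^+ 2] is nonnegative. *)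
have := mulr_ge0 (ltW alpha0) (sqr_ge0 G); have := mulr_ge0 (ltW alpha0) (sqr_ge0 Rad); lra.
Qed.
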